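(* Let $R$ be a P$v$MD. The following conditions are equivalent: (i) $R$ is a generalized Krull domain; (ii) each radical $t$-ideal of $R$ is divisorial and each divisorial ideal of $R$ is $w$-stable; (iii) each radical $t$-ideal of $R$ is $w$-stable; (iv) each $t$-prime ideal of $R$ is $w$-stable.
   Context: $R$ is an integral domain with quotient field $K\neq R$. For nonzero $R$-submodules $A,B$ of $K$, $(A:B)=\{x\in K: xB\subseteq A\}$; $E(I)=(I:I)$. For a nonzero fractional ideal $I$, $I_v=(R:(R:I))$ ($I$ divisorial if $I=I_v$), $I_t=\bigcup\{J_v: J\subseteq I\text{ nonzero finitely generated}\}$ ($I$ a $t$-ideal if $I=I_t$); $t$-primes are prime $t$-ideals; $t\text{-Max}(R)$ is the set of ideals maximal among proper $t$-ideals. For a nonzero $R$-submodule $E$ of $K$, $E_w=\bigcap_{M\in t\text{-Max}(R)}ER_M$; $I$ is a $w$-ideal if $I=I_w$. A $w$-ideal $I$ is $w$-stable if $(I(E(I):I))_w=E(I)$. $R$ is a P$v$MD if $R_M$ is a valuation domain for each $M\in t\text{-Max}(R)$. A P$v$MD is strongly discrete if $(P^2)_t\neq P$ for each $t$-prime $P$. A generalized Krull domain is a strongly discrete P$v$MD satisfying the ascending chain condition on radical $t$-ideals. *)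

(* Defs.v *)
(* Subsets of the quotient field K are predicates K -> Prop;
   the domain R is a subring of the field K whose fraction field is K. *)
From mathcomp Require Import all_boot all_algebra.
Set Implicit Arguments. Unset Strict Implicit. Unset Printing Implicit Defensive.
Import GRing.Theory.
Local Open Scope ring_scope.

Section Defs.
Variable K : fieldType.
Definition kset := K -> Prop.
Variable R : kset.

Definition subset_k (A B : kset) := forall x, A x -> B x.
Definition seteq (A B : kset) := forall x, A x <-> B x.
Definition nonzero_set (A : kset) := exists x, A x /\ x != 0.

Definition domain_with_qf :=
  [/\ R 1, (forall x y, R x -> R y -> R (x - y)),
      (forall x y, R x -> R y -> R (x * y)),
      (forall x, exists a b, [/\ R a, R b, b != 0 & x = a / b])
    & exists x, ~ R x].

Definition submodule (A : kset) :=
  [/\ A 0, (forall x y, A x -> A y -> A (x + y))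
    & (forall r x, R r -> A x -> A (r * x))].

Definition colon (A B : kset) : kset := fun x => forall b, B b -> A (x * b).
Definition Eend (I : kset) : kset := colon I I.

Definition fractional (I : kset) :=
  [/\ submodule I, nonzero_set I & exists d, [/\ R d, d != 0 & forall x, I x -> R (d * x)]].

Definition vcl (I : kset) : kset := colon R (colon R I).

Definition span (l : seq K) : kset := fun x =>
  exists r : nat -> K, (forall i, R (r i)) /\ x = \sum_(i < size l) r i * l`_i.
Definition fingen (J : kset) := exists l, seteq J (span l).

Definition tcl (I : kset) : kset := fun x =>
  exists J, [/\ submodule J, nonzero_set J, fingen J, subset_k J I & vcl J x].

Definition divisorial (I : kset) := fractional I /\ seteq I (vcl I).
Definition tideal (I : kset) := fractional I /\ seteq I (tcl I).
Definition integral (I : kset) := subset_k I R.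
Definition proper (I : kset) := exists x, R x /\ ~ I x.

Definition prime_ideal (P : kset) :=
  [/\ submodule P, integral P, proper P
    & forall a b, R a -> R b -> P (a * b) -> P a \/ P b].
Definition tprime (P : kset) := prime_ideal P /\ tideal P.

Definition tmax (M : kset) :=
  [/\ integral M, proper M, tideal M
    & forall J, integral J -> proper J -> tideal J -> subset_k M J -> seteq J M].

Definition loc (M : kset) : kset := fun x =>
  exists a s, [/\ R a, R s, ~ M s & x = a / s].

Definition mulmod (A B : kset) : kset := fun x =>
  exists s : seq (K * K), (forall p, p \in s -> A p.1 /\ B p.2)
                          /\ x = \sum_(p <- s) p.1 * p.2.

Definition wcl (E : kset) : kset := fun x => forall M, tmax M -> mulmod E (loc M) x.
Definition wideal (I : kset) := fractional I /\ seteq I (wcl I).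
Definition wstable (I : kset) :=
  wideal I /\ seteq (wcl (mulmod I (colon (Eend I) I))) (Eend I).

(* V (a subring of K with quotient field K) is a valuation domain *)
Definition valuation_dom (V : kset) := forall x, x != 0 -> V x \/ V x^-1.
Definition PvMD := forall M, tmax M -> valuation_dom (loc M).
Definition strongly_discrete :=
  PvMD /\ forall P, tprime P -> ~ seteq (tcl (mulmod P P)) P.

Definition radical_ideal (I : kset) := forall x n, R x -> I (x ^+ n.+1) -> I x.
Definition radical_tideal (I : kset) := [/\ integral I, tideal I & radical_ideal I].
Definition acc_radical_t :=
  forall f : nat -> kset, (forall n, radical_tideal (f n)) ->
    (forall n, subset_k (f n) (f n.+1)) ->
    exists n, forall m, (n <= m)%N -> seteq (f m) (f n).
Definition gen_krull := strongly_discrete /\ acc_radical_t.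

Definition divisorial_ideal (I : kset) := integral I /\ divisorial I.
End Defs.

(* Main.v *)
(** In a PvMD the t- and w-closures agree, so membership in a t-ideal can be
    tested at each maximal t-ideal [M], where [R_M] is a valuation domain.

    (iv) -> (i).  Put [T = (P : P)].  If [P] is w-stable, then [1] lies in the
    t-closure of finitely many elements of [P (T : P)], and these only involve a
    finite subset [l] of [P]; since [T P P] is contained in [R], the square of
    every element of [P] lies in the v-closure of [l].  So every t-prime is the
    radical of a finitely generated t-ideal, and a Cohen-type argument gives the
    chain condition.  If moreover [P = (P^2)_t], then [(T : P)] is contained in
    [T], whence [1] lies in [P], a contradiction.

    (i) -> (ii).  By the chain condition a radical t-ideal [N] is a finite
    intersection of t-primes, and strong discreteness yields a finite subset [l]
    of [N] with radical [N] such that [l] and [P] generate the same ideal of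
    [R_P] for every minimal prime [P] of [N].  Then [(R : l) N] is contained in
    [(N : N)], from which divisoriality of [N] is read off locally.  If [I] is
    divisorial, put [H = I (R : I)] and let [N] be the radical of [H_t].
    Divisoriality gives [(I : I) = (R : H) = (N : N)]; this forces
    [H R_P = P R_P] for the minimal primes [P] of [N], so [(R : l) H], a subset
    of [I ((I : I) : I)], is contained in no maximal t-ideal. *)
From mathcomp Require Import all_boot all_algebra.
From mathcomp Require Import boolp classical_sets.
From Stdlib Require List.
From mathcomp Require Import ring.
Require Import Defs.
Set Implicit Arguments. Unset Strict Implicit. Unset Printing Implicit Defensive.
Import GRing.Theory.
Local Open Scope ring_scope.

(** Serves twice: to find maximal t-ideals and in Cohen's argument. Only nonempty chains have to be
    bounded. *)
Lemma zorn_kset (K : fieldType) (Q : kset K -> Prop) (A0 : kset K) :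
  Q A0 ->
  (forall F : set (kset K), (exists X, F X) -> (forall X, F X -> Q X) ->
     (forall X Y, F X -> F Y -> subset_k X Y \/ subset_k Y X) ->
     Q (fun x => exists2 X, F X & X x)) ->
  exists B, [/\ subset_k A0 B, Q B &
    forall C, Q C -> subset_k B C -> subset_k C B].
Proof.
move=> QA0 chain.
(* [Zorn_bigcup] also asks for the union of the empty chain, hence the first disjunct. *)
pose P : set (kset K) := fun X => (forall x, ~ X x) \/ (subset_k A0 X /\ Q X).
have [F FP Ftot|B [PB maxB]] := @Zorn_bigcup K P.
  have [nex|ex] := pselect (exists2 X, F X & exists x, X x); last first.
    by left=> x [X FX Xx]; apply: ex; exists X => //; exists x.
  case: nex => X0 FX0 [x0 X0x0].
  pose G : set (kset K) := fun X => F X /\ exists x, X x.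
  have GA X : G X -> subset_k A0 X /\ Q X.
    by case=> /FP[emX [x Xx]|//]; case: (emX x).
  have -> : (\bigcup_(X in F) X)%classic = (fun x => exists2 X, G X & X x).
    apply/predeqP => x; split.
      by case=> X FX Xx; exists X => //; split=> //; exists x.
    by case=> X [FX _] Xx; exists X.
  have GX0 : G X0 by split=> //; exists x0.
  right; split; first by have [A0X0 _] := GA X0 GX0; move=> x /A0X0; exists X0.
  apply: chain; first by exists X0.
    by move=> X /GA[].
  by move=> X Y [FX _] [FY _]; case: (Ftot X Y FX FY); [left|right].
have [A0B QB] : subset_k A0 B /\ Q B.
  case: PB => // emB.
  have emA x : ~ A0 x.
    move=> A0x; apply: (maxB A0); last by right; split.
    split; last by move/(_ x A0x); apply: emB.
    by move=> y /emB.
  have BA0 : B = A0 by apply/predeqP => y; split=> [/emB|/emA].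
  by rewrite BA0; split.
exists B; split=> // C QC BC; apply: contrapT => nCB.
apply: (maxB C); first by split.
by right; split=> // x A0x; apply/BC/A0B.
Qed.

(** * The v-, t- and w-closures and maximal t-ideals *)

Section Closures.
Variables (K : fieldType) (R : kset K).
Hypothesis domR : domain_with_qf R.

Let R1 : R 1. Proof. by case: domR. Qed.
Let RB x y : R x -> R y -> R (x - y). Proof. by case: domR => _ + _ _ _; apply. Qed.
Let RM x y : R x -> R y -> R (x * y). Proof. by case: domR => _ _ + _ _; apply. Qed.
Let R0 : R 0. Proof. by rewrite -(subrr 1); apply: RB. Qed.
Let RN x : R x -> R (- x). Proof. by move=> Rx; rewrite -sub0r; apply: RB. Qed.
Let RD x y : R x -> R y -> R (x + y).
Proof. by move=> Rx Ry; rewrite -(opprK y); apply: RB => //; apply: RN. Qed.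
Let RX x n : R x -> R (x ^+ n).
Proof. by move=> Rx; elim: n => [|n IH]; rewrite ?expr0 // exprS; apply: RM. Qed.
Let Rfrac x : exists b, [/\ R b, b != 0 & R (b * x)].
Proof.
case: domR => _ _ _ /(_ x)[a [b [Ra Rb b0 ->]]] _; exists b; split=> //.
by rewrite mulrC divfK.
Qed.

(** [vspan l] is the v-closure of the module generated by [l], and [tspan I]
    is the t-closure of [I]; unlike [vcl] and [tcl], they need no side
    condition on [l] and [I]. *)
Definition vspan (l : seq K) : kset K := fun x =>
  forall z, (forall y, y \in l -> R (z * y)) -> R (z * x).
Definition tspan (I : kset K) : kset K := fun x =>
  exists l : seq K, (forall y, y \in l -> I y) /\ vspan l x.
Definition wspan (I : kset K) : kset K := fun x =>
  forall M, tmax R M -> exists s, [/\ R s, ~ M s & I (s * x)].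

Lemma mem_vspan l x : x \in l -> vspan l x.
Proof. by move=> lx z; apply. Qed.

Lemma vspan_trans l l' x :
  (forall y, y \in l -> vspan l' y) -> vspan l x -> vspan l' x.
Proof. by move=> ll' lx z zl'; apply: lx => y /ll'; apply. Qed.

Lemma vspan_mul l l' x y :
  vspan l x -> vspan l' y -> vspan [seq u * v | u <- l, v <- l'] (x * y).
Proof.
move=> lx ly z zl; rewrite mulrA; apply: (ly (z * x)) => v l'v.
rewrite mulrAC; apply: (lx (z * v)) => u lu.
by rewrite -mulrA (mulrC v); apply: zl; apply/allpairsP; exists (u, v).
Qed.

Lemma vspan_scale l x u : vspan l x -> vspan [seq u * y | y <- l] (u * x).
Proof.
move=> lx z zl; rewrite mulrA; apply: lx => y ly; rewrite -mulrA.
by apply/zl/map_f.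
Qed.

Lemma vspan_mulR l r x : R r -> vspan l x -> vspan l (r * x).
Proof. by move=> Rr lx z zl; rewrite mulrCA; apply/RM/lx. Qed.

Lemma vspan_integral l x : (forall y, y \in l -> R y) -> vspan l x -> R x.
Proof.
by move=> lR /(_ 1); rewrite mul1r; apply=> y /lR; rewrite mul1r.
Qed.

Lemma sub_tspan I : subset_k I (tspan I).
Proof.
move=> x Ix; exists [:: x]; split; last by apply: mem_vspan; rewrite inE.
by move=> y; rewrite inE => /eqP->.
Qed.

Lemma tspan_integral I : integral R I -> integral R (tspan I).
Proof. by move=> IR x [l [lI]]; apply: vspan_integral => y /lI/IR. Qed.

Lemma tspan_mono I J : subset_k I J -> subset_k (tspan I) (tspan J).
Proof. by move=> IJ x [l [lI lx]]; exists l; split=> // y /lI/IJ. Qed.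

Lemma tspan_mul A B C x y : (forall a b, A a -> B b -> C (a * b)) ->
  tspan A x -> tspan B y -> tspan C (x * y).
Proof.
move=> ABC [l [lA lx]] [l' [l'B l'y]].
exists [seq u * v | u <- l, v <- l']; split; last exact: vspan_mul.
by move=> z /allpairsP[[u v] [/= /lA Au /l'B Bv ->]]; apply: ABC.
Qed.

Lemma tspan_scale A C u x : (forall a, A a -> C (u * a)) ->
  tspan A x -> tspan C (u * x).
Proof.
move=> AC [l [lA lx]]; exists [seq u * y | y <- l].
by split; [move=> _ /mapP[y /lA Ay ->]; apply: AC|apply: vspan_scale].
Qed.

Lemma tspan_expr A u x n : (forall a, A a -> A (u * a)) ->
  tspan A x -> tspan A (u ^+ n * x).
Proof.
move=> Au; elim: n => [|n IH] in x *; first by rewrite expr0 mul1r.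
by move=> Ax; rewrite exprSr -mulrA; apply/IH/(tspan_scale Au).
Qed.

(** The map [g] is the identity for idempotence of [tspan] and a power map in [tradical_vspan]. *)
Lemma tspan_seq (A : kset K) (T : eqType) (g : T -> K) (l : seq T) :
  (forall y, y \in l -> tspan A (g y)) ->
  exists l', (forall y, y \in l' -> A y) /\ forall y, y \in l -> vspan l' (g y).
Proof.
elim: l => [|a l IH] tl; first by exists [::].
have [|l1 [l1A l1l]] := IH; first by move=> y ly; apply: tl; rewrite inE ly orbT.
have [|l2 [l2A l2a]] := tl a; first by rewrite inE eqxx.
exists (l1 ++ l2); split=> [y|y].
  by rewrite mem_cat => /orP[/l1A|/l2A].
rewrite inE => /orP[/eqP->|/l1l yl1].
  by apply: (vspan_trans _ l2a) => z l2z; apply: mem_vspan; rewrite mem_cat l2z orbT.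
by apply: (vspan_trans _ yl1) => z l1z; apply: mem_vspan; rewrite mem_cat l1z.
Qed.

Lemma tspan_idem A : subset_k (tspan (tspan A)) (tspan A).
Proof.
move=> x [l [lA lx]]; have [l' [l'A l'l]] := tspan_seq (g := id) lA.
by exists l'; split=> //; apply: vspan_trans lx.
Qed.

Lemma tspan_submodule A : submodule R (tspan A).
Proof.
split=> [|x y Ax Ay|r x Rr [l [lA lx]]].
- by exists [::]; split=> // z _; rewrite mulr0.
- apply: tspan_idem; exists [:: x; y]; split.
    by move=> z; rewrite !inE => /orP[]/eqP->.
  by move=> z zl; rewrite mulrDr; apply: RD; apply: zl; rewrite !inE eqxx ?orbT.
- by exists l; split=> //; apply: vspan_mulR.
Qed.

Lemma submodule_sum A (T : Type) (s : seq T) (P : pred T) (f : T -> K) :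
  submodule R A -> (forall i, P i -> A (f i)) -> A (\sum_(i <- s | P i) f i).
Proof. by case=> A0 AD _ Af; apply: big_ind. Qed.

Lemma properP A : submodule R A -> integral R A -> Defs.proper R A <-> ~ A 1.
Proof.
case=> _ _ AM AR; split; first by move=> [x [Rx Ax]] A1; apply: Ax; rewrite -[x]mulr1; apply: AM.
by exists 1.
Qed.

Lemma span_vspan l : subset_k (span R l) (vspan l).
Proof.
move=> x [r [Rr ->]] z zl; rewrite mulr_sumr.
apply: (big_ind R) => // i _; rewrite mulrCA; apply: RM => //.
by apply/zl/mem_nth.
Qed.

Lemma span_submodule l : submodule R (span R l).
Proof.
split.
- by exists (fun=> 0); split=> //; rewrite big1 // => i _; rewrite mul0r.
- move=> _ _ [r [Rr ->]] [r' [Rr' ->]]; exists (fun i => r i + r' i); split.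
    by move=> i; apply: RD.
  by rewrite -big_split; apply: eq_bigr => i _; rewrite mulrDl.
- move=> c _ Rc [r [Rr ->]]; exists (fun i => c * r i); split.
    by move=> i; apply: RM.
  by rewrite mulr_sumr; apply: eq_bigr => i _; rewrite mulrA.
Qed.

Lemma mem_span l y : y \in l -> span R l y.
Proof.
move=> ly; exists (fun i => if i == index y l then 1 else 0); split.
  by move=> i; case: ifP.
have il : (index y l < size l)%N by rewrite index_mem.
rewrite (bigD1 (Ordinal il)) //= eqxx mul1r nth_index // big1 ?addr0 // => i.
by rewrite -val_eqE /= => /negPf->; rewrite mul0r.
Qed.

Lemma span_sub A l : submodule R A -> (forall y, y \in l -> A y) -> subset_k (span R l) A.
Proof.
move=> mA lA _ [r [Rr ->]]; apply: submodule_sum => // i _.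
by case: mA => _ _; apply=> //; apply/lA/mem_nth.
Qed.

Lemma vcl_span l : seteq (vcl R (span R l)) (vspan l).
Proof.
move=> x; split=> vx z zl; last by rewrite mulrC; apply: vx => y ly; apply/zl/mem_span.
rewrite mulrC; apply: vx => b /span_vspan; exact.
Qed.

Lemma vcl_mono A B : subset_k A B -> subset_k (vcl R A) (vcl R B).
Proof. by move=> AB x vx z zB; apply: vx => b /AB/zB. Qed.

Lemma tclE I : submodule R I -> nonzero_set I -> seteq (tcl R I) (tspan I).
Proof.
move=> mI [a [Ia a0]] x; split.
  case=> J [_ _ [l lJ] JI vx]; exists l; split; first by move=> y ly; apply/JI/lJ/mem_span.
  by apply/vcl_span; apply: vcl_mono vx => y /lJ.
(* Prepending [a] keeps the finitely generated module nonzero, as [tcl] demands. *)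
case=> l [lI lx]; exists (span R (a :: l)).
have aI y : y \in a :: l -> I y by rewrite inE => /orP[/eqP->|/lI].
split; first exact: span_submodule.
- by exists a; split=> //; apply: mem_span; rewrite inE eqxx.
- by exists (a :: l).
- exact: span_sub.
- apply/vcl_span; apply: vspan_trans lx => y ly; apply: mem_vspan.
  by rewrite inE ly orbT.
Qed.

Lemma tideal_integralP I : integral R I ->
  tideal R I <-> [/\ submodule R I, nonzero_set I & subset_k (tspan I) I].
Proof.
move=> IR; split=> [[[mI nI _] It]|[mI nI It]].
  by split=> // x /(tclE mI nI) /It.
split; first by split=> //; exists 1; split; rewrite ?oner_neq0 // => x /IR; rewrite mul1r.
move=> x; split; first by move=> Ix; apply/(tclE mI nI)/sub_tspan.
by move/(tclE mI nI)/It.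
Qed.

Lemma tmaxP M : tmax R M -> [/\ integral R M, submodule R M, nonzero_set M,
  subset_k (tspan M) M & ~ M 1].
Proof.
case=> MR pM /(tideal_integralP MR)[mM nM Mt] _; split=> //.
exact/properP.
Qed.

Lemma chain_seq (F : set (kset K)) (l : seq K) :
  (exists X, F X) ->
  (forall X Y, F X -> F Y -> subset_k X Y \/ subset_k Y X) ->
  (forall y, y \in l -> exists2 X, F X & X y) ->
  exists2 X, F X & forall y, y \in l -> X y.
Proof.
move=> exF Ftot; elim: l => [|a l IH] lF; first by case: exF => X FX; exists X.
have [|X FX lX] := IH; first by move=> y ly; apply: lF; rewrite inE ly orbT.
have [|Y FY Ya] := lF a; first by rewrite inE eqxx.
have [XY|YX] := Ftot X Y FX FY; [exists Y => //|exists X => //] => y.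
  by rewrite inE => /orP[/eqP->//|/lX/XY].
by rewrite inE => /orP[/eqP->|/lX//]; apply: YX.
Qed.

Lemma chain_submodule (F : set (kset K)) :
  (exists X, F X) -> (forall X, F X -> submodule R X) ->
  (forall X Y, F X -> F Y -> subset_k X Y \/ subset_k Y X) ->
  submodule R (fun x => exists2 X, F X & X x).
Proof.
move=> exF Fm Ftot; split.
- by case: exF => X FX; exists X => //; case: (Fm X FX).
- move=> x y xF yF; have [|X FX lX] := @chain_seq F [:: x; y] exF Ftot.
    by move=> z; rewrite !inE => /orP[]/eqP->.
  by exists X => //; case: (Fm X FX) => _ + _; apply; apply: lX; rewrite !inE eqxx ?orbT.
- by move=> r x Rr [X FX Xx]; exists X => //; case: (Fm X FX) => _ _; apply.
Qed.

(** That [1] lies in a t-closure is witnessed by a finite list, so ideals with proper t-closure are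
    stable under unions of chains. A maximal one is a t-ideal, since its t-closure is again a
    candidate. *)
Lemma sub_tmax A : submodule R A -> integral R A -> nonzero_set A ->
  ~ tspan A 1 -> exists2 M, tmax R M & subset_k A M.
Proof.
move=> mA AR nA tA.
pose Q (B : kset K) := [/\ submodule R B, integral R B & ~ tspan B 1].
have [//||B [AB [mB BR tB] maxB]] := @zorn_kset K Q A.
  move=> F exF FQ Ftot; split.
  - by apply: chain_submodule => // X /FQ[].
  - by move=> x [X /FQ[_ + _] Xx]; apply.
  - move=> [l [lF l1]]; have [X FX lX] := chain_seq exF Ftot lF.
    by case: (FQ X FX) => _ _; apply; exists l.
have Bt : subset_k (tspan B) B.
  apply: maxB (@sub_tspan B); split; first exact: tspan_submodule.
    exact: tspan_integral.
  by move/tspan_idem.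
have nB : nonzero_set B by case: nA => a [/AB Ba a0]; exists a.
have B1 : ~ B 1 by move/sub_tspan.
exists B => //; split=> //; first exact/properP.
  exact/tideal_integralP.
move=> J JR pJ /(tideal_integralP JR)[mJ _ Jt] BJ x; split; last exact: BJ.
apply: maxB => //; split=> //.
by move/Jt; apply/(properP mJ JR).
Qed.

Lemma conductor_nonzero I x : submodule R I -> nonzero_set I ->
  exists r, [/\ R r, I (r * x) & r != 0].
Proof.
case=> I0 _ IM [i [Ii i0]].
have [b [Rb b0 Rbx]] := Rfrac x; have [d [Rd d0 Rdi]] := Rfrac i.
exists (b * (d * i)); split; first exact: RM.
  by rewrite mulrAC (mulrA _ d); apply: IM => //; apply: RM.
by rewrite !mulf_neq0.
Qed.

(** The conductor [A] of [x] into [I] lies in no maximal t-ideal, so its t-closure contains [1]. *)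
Lemma unit_vspan I x : submodule R I -> nonzero_set I -> wspan I x ->
  exists l, [/\ forall y, y \in l -> R y, forall y, y \in l -> I (y * x) & vspan l 1].
Proof.
move=> mI nI wx; pose A : kset K := fun r => R r /\ I (r * x).
case: (mI) => I0 ID IM.
have mA : submodule R A.
  split; first by split; rewrite ?mul0r.
    by move=> y z [Ry Iy] [Rz Iz]; split; [exact: RD|rewrite mulrDl; apply: ID].
  by move=> r y Rr [Ry Iy]; split; [exact: RM|rewrite -mulrA; apply: IM].
have nA : nonzero_set A.
  by have [r [Rr Ir r0]] := conductor_nonzero x mI nI; exists r.
have [[l [lA l1]]|tA] := pselect (tspan A 1).
  by exists l; split=> // y /lA[].
have AR : integral R A by move=> y [].
have [M tM AM] := sub_tmax mA AR nA tA.
by have [s [Rs Ms Is]] := wx M tM; case: Ms; apply: AM.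
Qed.

Lemma submodule_self : submodule R R. Proof. by split. Qed.
Lemma nonzero_self : nonzero_set R. Proof. by exists 1; rewrite oner_neq0. Qed.

(** Integrality can thus be tested at each maximal t-ideal. *)
Lemma wspan_R : subset_k (wspan R) R.
Proof.
move=> x /(unit_vspan submodule_self nonzero_self)[l [_ lx /(_ x)]]; rewrite mulr1; apply=> y.
by rewrite mulrC; apply: lx.
Qed.

Lemma wspan_tspan I : submodule R I -> nonzero_set I -> subset_k (wspan I) (tspan I).
Proof.
move=> mI nI x /(unit_vspan mI nI)[l [_ lx l1]]; exists [seq x * y | y <- l].
split; last by rewrite -[x in vspan _ x]mulr1; apply: vspan_scale.
by move=> _ /mapP[y ly ->]; rewrite mulrC; apply: lx.
Qed.

Definition adjoin (A : kset K) (a : K) : kset K :=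
  fun x => exists m r, [/\ A m, R r & x = m + r * a].

Lemma adjoin_submodule A a : submodule R A -> submodule R (adjoin A a).
Proof.
case=> A0 AD AM; split.
- by exists 0, 0; split=> //; rewrite mul0r addr0.
- move=> _ _ [m [r [Am Rr ->]]] [m' [r' [Am' Rr' ->]]].
  by exists (m + m'), (r + r'); split; [exact: AD|exact: RD|ring].
- move=> c _ Rc [m [r [Am Rr ->]]].
  by exists (c * m), (c * r); split; [exact: AM|exact: RM|ring].
Qed.

Lemma sub_adjoin A a : subset_k A (adjoin A a).
Proof. by move=> x Ax; exists x, 0; split=> //; rewrite mul0r addr0. Qed.

Lemma adjoin_mem A a : submodule R A -> adjoin A a a.
Proof. by case=> A0 _ _; exists 0, 1; split=> //; rewrite mul1r add0r. Qed.

Lemma adjoin_integral A a : integral R A -> R a -> integral R (adjoin A a).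
Proof. by move=> AR Ra _ [m [r [/AR Am Rr ->]]]; apply/RD/RM. Qed.

(** This turns maximality into primality: it serves for maximal t-ideals, for Cohen's argument, and
    for splitting a radical t-ideal that is not prime. *)
Lemma adjoin_mul A a b u v : submodule R A -> integral R A -> R a -> R b ->
  A (a * b) -> adjoin A a u -> adjoin A b v -> A (u * v).
Proof.
case=> A0 AD AM AR Ra Rb Aab [m [r [Am Rr ->]]] [m' [r' [Am' Rr' ->]]].
have -> : (m + r * a) * (m' + r' * b) =
  (m' + r' * b) * m + ((r * a) * m' + (r * r') * (a * b)) by ring.
apply/AD; first by apply: AM => //; apply/RD/RM => //; apply: AR.
by apply: AD; apply: AM => //; apply: RM.
Qed.

(** If [a] and [b] were outside [M], maximality would put [1] in the t-closures of [M + Ra] and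
    [M + Rb], hence in that of their product, which lies in [M]. *)
Lemma tmax_prime M a b : tmax R M -> R a -> R b -> M (a * b) -> M a \/ M b.
Proof.
move=> tM Ra Rb Mab; have [MR mM [c [Mc c0]] Mt M1] := tmaxP tM.
have key d : R d -> ~ M d -> tspan (adjoin M d) 1.
  move=> Rd Md; apply: contrapT => t1.
  have [|||N tN dN] := sub_tmax _ _ _ t1.
  - exact: adjoin_submodule.
  - exact: adjoin_integral.
  - by exists c; split=> //; apply: sub_adjoin.
  case: (tM) => _ _ _ maxM; have [NR pN tN' _] := tN.
  apply: Md; apply/(maxM N NR pN tN'); last exact/dN/adjoin_mem.
  by move=> x Mx; apply/dN/sub_adjoin.
apply: contrapT => /not_orP[Ma Mb]; apply: M1; apply: Mt; rewrite -[1]mulr1.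
apply: tspan_mul (key a Ra Ma) (key b Rb Mb) => u v.
exact: adjoin_mul.
Qed.

Lemma tmax_mulN M a b : tmax R M -> R a -> R b -> ~ M a -> ~ M b -> ~ M (a * b).
Proof. by move=> tM Ra Rb Ma Mb /(tmax_prime tM Ra Rb)[]. Qed.

Lemma tmax_expN M a n : tmax R M -> R a -> ~ M a -> ~ M (a ^+ n).
Proof.
move=> tM Ra Ma; have [_ _ _ _ M1] := tmaxP tM.
elim: n => [|n IH]; first by rewrite expr0.
by rewrite exprS; apply: tmax_mulN => //; apply: RX.
Qed.

Lemma wclE E : submodule R E -> seteq (wcl R E) (wspan E).
Proof.
case=> E0 ED EM x; split=> wx M tM; have [MR [M0 _ _] _ _ M1] := tmaxP tM; last first.
  have [s [Rs Ms Es]] := wx M tM; exists [:: (s * x, s^-1)]; split.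
    move=> p; rewrite inE => /eqP-> /=; split=> //.
    by exists 1, s; rewrite div1r.
  rewrite big_seq1 /= mulrAC divff ?mul1r //.
  by apply/eqP => s0; apply: Ms; rewrite s0.
have [l [lE ->]] := wx M tM; elim: l lE => [|p l IH] lE.
  by exists 1; split=> //; rewrite big_nil mulr0.
have [|s [Rs Ms Es]] := IH; first by move=> q lq; apply: lE; rewrite inE lq orbT.
have [|Ep [a [t [Ra Rt Mt p2]]]] := lE p; first by rewrite inE eqxx.
exists (s * t); split; [exact: RM|exact: tmax_mulN|].
rewrite big_cons p2 mulrDr; apply: ED; last first.
  by rewrite (mulrC s) -mulrA; apply: EM.
have -> : s * t * (p.1 * (a / t)) = (s * a) * p.1.
  have t0 : t != 0 by apply/eqP => t0; apply: Mt; rewrite t0.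
  by field.
by apply: EM => //; apply: RM.
Qed.

Lemma mulmod_submodule A B : submodule R A -> submodule R (mulmod A B).
Proof.
case=> A0 AD AM; split.
- by exists [::]; rewrite big_nil.
- move=> _ _ [l [lAB ->]] [l' [l'AB ->]]; exists (l ++ l'); rewrite big_cat; split=> //.
  by move=> p; rewrite mem_cat => /orP[/lAB|/l'AB].
- move=> r _ Rr [l [lAB ->]]; exists [seq (r * p.1, p.2) | p <- l]; split.
    by move=> _ /mapP[p /lAB[Ap Bp] ->]; split=> //; apply: AM.
  by rewrite big_map mulr_sumr; apply: eq_bigr => p _; rewrite mulrA.
Qed.

Lemma mem_mulmod (A B : kset K) a b : A a -> B b -> mulmod A B (a * b).
Proof.
move=> Aa Bb; exists [:: (a, b)]; rewrite big_seq1; split=> // p.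
by rewrite inE => /eqP->.
Qed.

Lemma mulmod_scale (A B D E : kset K) u x :
  (forall a b, A a -> B b -> mulmod D E (u * (a * b))) ->
  submodule R D -> mulmod A B x -> mulmod D E (u * x).
Proof.
move=> ABC mD [l [lAB ->]]; rewrite mulr_sumr big_seq.
apply: submodule_sum; first exact: mulmod_submodule.
by move=> p /lAB[]; apply: ABC.
Qed.

Lemma mulmod_sub (A B C : kset K) : submodule R C ->
  (forall a b, A a -> B b -> C (a * b)) -> subset_k (mulmod A B) C.
Proof.
move=> mC ABC _ [l [lAB ->]]; rewrite big_seq; apply: submodule_sum => // p.
by case/lAB; apply: ABC.
Qed.

Lemma vspan_sum (T : eqType) l (s : seq T) (f : T -> K) :
  (forall i, i \in s -> vspan l (f i)) -> vspan l (\sum_(i <- s) f i).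
Proof.
move=> lf z zl; rewrite mulr_sumr big_seq; apply: (big_ind R) => // i si.
exact: lf.
Qed.

Lemma vspan_sub l l' x : {subset l <= l'} -> vspan l x -> vspan l' x.
Proof. by move=> ll' lx; apply: (vspan_trans _ lx) => y /ll' l'y; apply: mem_vspan. Qed.

(** ** Stable t-primes and the chain condition *)

Definition rad_fingen (I : kset K) := exists l : seq K,
  (forall y, y \in l -> I y) /\ forall x, I x -> exists n, vspan l (x ^+ n.+1).

Lemma prime_ideal_expr P x n : prime_ideal R P -> R x -> P (x ^+ n.+1) -> P x.
Proof.
case=> _ _ _ pP Rx; elim: n => [//|n IH]; rewrite exprS => Px.
by have [//|/IH] := pP _ _ Rx (RX n.+1 Rx) Px.
Qed.

(* Cohen's argument: a t-ideal maximal among those that are not radicals of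
   finitely generated ones is prime. *)
Lemma not_rad_fingen_tprime I : integral R I -> tideal R I -> ~ rad_fingen I ->
  exists2 P, tprime R P & ~ rad_fingen P.
Proof.
move=> IR /(tideal_integralP IR)[mI nI It] fI.
pose Q B := [/\ submodule R B, integral R B, subset_k (tspan B) B & ~ rad_fingen B].
have [//||P [IP [mP PR Pt fP] maxP]] := @zorn_kset K Q I.
  move=> F exF FQ Ftot.
  have uni (l : seq K) : (forall y, y \in l -> exists2 X, F X & X y) ->
      exists2 X, F X & forall y, y \in l -> X y.
    exact: chain_seq exF Ftot.
  split.
  - by apply: chain_submodule => // X /FQ[].
  - by move=> x [X /FQ[_ + _ _] Xx]; apply.
  - move=> x [l [/uni[X FX lX] lx]]; exists X => //.
    by case: (FQ X FX) => _ _ + _; apply; exists l.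
  - move=> [l [/uni[X FX lX] lrad]]; case: (FQ X FX) => _ _ _; apply.
    by exists l; split=> // x Xx; apply: lrad; exists X.
have nP : nonzero_set P by case: nI => i [/IP Pi i0]; exists i.
exists P => //; split; last exact/tideal_integralP.
split=> //.
  apply/(properP mP PR) => P1; apply: fP; exists [:: 1]; split.
    by move=> y; rewrite inE => /eqP->.
  move=> x Px; exists 0; rewrite expr1 -[x]mulr1; apply: vspan_mulR; first exact: PR.
  by apply: mem_vspan; rewrite inE.
have key a : R a -> ~ P a -> exists l : seq K,
    (forall y, y \in l -> tspan (adjoin P a) y) /\
    forall x, P x -> exists n, vspan l (x ^+ n.+1).
  move=> Ra Pa; have [[l [la lrad]]|nf] := pselect (rad_fingen (tspan (adjoin P a))).
    exists l; split=> // x Px; apply: lrad; apply/sub_tspan.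
    exact: sub_adjoin.
  case: Pa; apply: (maxP (tspan (adjoin P a))).
  - split=> //; first exact: tspan_submodule.
      by apply/tspan_integral/adjoin_integral.
    exact: tspan_idem.
  - by move=> x Px; apply/sub_tspan/sub_adjoin.
  - by apply/sub_tspan/adjoin_mem.
move=> a b Ra Rb Pab; apply: contrapT => /not_orP[Pa Pb]; apply: fP.
have [[l [la lrad]] [l' [l'b l'rad]]] := (key a Ra Pa, key b Rb Pb).
exists [seq u * v | u <- l, v <- l']; split.
  move=> _ /allpairsP[[u v] [/= /la tu /l'b tv ->]]; apply: Pt.
  by apply: tspan_mul tu tv => c d; apply: adjoin_mul.
move=> x Px; have [[n ln] [m lm]] := (lrad x Px, l'rad x Px).
by exists (n + m.+1)%N; rewrite -addSn exprD; apply: vspan_mul.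
Qed.

(** The union of the chain is a t-ideal, so Cohen's argument makes it the radical of a finite list.
    The chain is constant from any term containing that list. *)
Lemma acc_of_rad_fingen :
  (forall P, tprime R P -> rad_fingen P) -> acc_radical_t R.
Proof.
move=> fP f rf fS.
have fle n m : (n <= m)%N -> subset_k (f n) (f m).
  move=> /subnKC <-; elim: (m - n)%N => [|k IH]; first by rewrite addn0.
  by rewrite addnS => x /IH /fS.
pose F : set (kset K) := fun X => exists n, X = f n.
have fm X : F X -> [/\ integral R X, submodule R X, nonzero_set X & subset_k (tspan X) X].
  by case=> n ->; have [IR /(tideal_integralP IR)[]] := rf n.
have exF : exists X, F X by exists (f 0), 0.
have Ftot X Y : F X -> F Y -> subset_k X Y \/ subset_k Y X.
  by move=> [n ->] [m ->]; have [/fle|/ltnW/fle] := leqP n m; [left|right].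
pose I : kset K := fun x => exists2 X, F X & X x.
have IR : integral R I by move=> x [X /fm[XR _ _ _]]; apply: XR.
have tI : tideal R I.
  apply/tideal_integralP => //; split.
  - by apply: chain_submodule => // X /fm[].
  - by have [X FX] := exF; have [_ _ [x [Xx x0]] _] := fm X FX; exists x; split=> //; exists X.
  - move=> x [l [lI lx]]; have [X FX lX] := chain_seq exF Ftot lI; exists X => //.
    by have [_ _ _] := fm X FX; apply; exists l.
have [l [lI lrad]] : rad_fingen I.
  apply: contrapT => /(not_rad_fingen_tprime IR tI)[P /fP fgP]; exact.
have [_ [n ->] ln] := chain_seq exF Ftot lI.
exists n => m nm x; split; last exact: fle.
move=> fmx; have [|k lk] := lrad x; first by exists (f m) => //; exists m.
have [_ _ radn] := rf n; have [fR _ _] := rf m.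
apply: (radn x k); first exact: fR.
have [_ _ _] := fm (f n) (ex_intro _ n erefl); apply; by exists l.
Qed.

Lemma wstable_tspan1 P : tprime R P -> wstable R P ->
  tspan (mulmod P (colon (Eend P) P)) 1.
Proof.
move=> [[mP PR _ _] tP] [_ /(_ 1)[_ w1]].
have [_ [p [Pp p0]] _] := (tideal_integralP PR).1 tP.
have mPY : submodule R (mulmod P (colon (Eend P) P)) by apply: mulmod_submodule.
apply: wspan_tspan => //.
  exists (p * 1); rewrite mulr1; split=> //; rewrite -[p]mulr1; apply: mem_mulmod => //.
  by move=> b /PR Rb c Pc; rewrite mul1r; case: mP => _ _; apply.
by apply/(wclE mPY)/w1 => c Pc; rewrite mul1r.
Qed.

Lemma wstable_tprime_rad_fingen P : tprime R P -> wstable R P -> rad_fingen P.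
Proof.
move=> tP wP; have [F [FP F1]] := wstable_tspan1 tP wP.
have [[mP PR _ _] _] := tP.
have [l [lP lF]] : exists l : seq K, (forall y, y \in l -> P y) /\
    forall f x, f \in F -> P x -> vspan l (x ^+ 2 * f).
  elim: F FP {F1} => [|f F IH] FP; first by exists [::].
  have [|l [lP lF]] := IH; first by move=> g Fg; apply: FP; rewrite inE Fg orbT.
  have [|s [sP fE]] := FP f; first by rewrite inE eqxx.
  exists ([seq p.1 | p <- s] ++ l); split.
    by move=> y; rewrite mem_cat => /orP[/mapP[p /sP[Pp _] ->]|/lP].
  move=> g x; rewrite inE => /orP[/eqP->|Fg] Px; last first.
    by apply: (vspan_sub _ (lF g x Fg Px)) => y ly; rewrite mem_cat ly orbT.
  rewrite fE mulr_sumr; apply: vspan_sum => p sp.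
  have [_ Yp] := sP p sp.
  (* Since [p.2 * x] maps [P] into itself, the coefficient of [p.1] is integral. *)
  have -> : x ^+ 2 * (p.1 * p.2) = (p.2 * x * x) * p.1 by ring.
  apply: vspan_mulR; first by apply/PR/Yp.
  by apply: mem_vspan; rewrite mem_cat map_f.
exists l; split=> // x Px; exists 1; rewrite -[x ^+ 2]mulr1 => z zl.
rewrite mulrA; apply: F1 => f Ff; rewrite -mulrA; exact: lF.
Qed.

Lemma wstable_tprime_not_idem P : tprime R P -> wstable R P ->
  ~ seteq (tcl R (mulmod P P)) P.
Proof.
move=> tP wP idP; have t1 := wstable_tspan1 tP wP.
have [[mP PR pP _] tidP] := tP.
have [_ [p [Pp p0]] Pt] := (tideal_integralP PR).1 tidP.
have nPP : nonzero_set (mulmod P P).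
  by exists (p * p); split; [exact: mem_mulmod|rewrite mulf_neq0].
have mPP : submodule R (mulmod P P) by apply: mulmod_submodule.
move/(properP mP PR): pP; apply; apply/Pt; apply: tspan_mono t1.
apply: mulmod_sub => // a y Pa Yy.
have /(tclE mPP nPP) taa : tcl R (mulmod P P) a by apply/idP.
(* [y] sends a product of two elements of [P] into [P]: it moves the first factor into [(P : P)],
   which acts on the second. Hence it also sends [a] into [P]. *)
rewrite mulrC; apply: Pt; apply: tspan_scale taa => _ [s [sP ->]].
rewrite mulr_sumr big_seq; apply: submodule_sum => // q sq.
by have [P1 P2] := sP q sq; rewrite mulrA; apply: Yy.
Qed.

(** [y] divides [x] in the localization of [R] at [M]. *)
Definition dvd_at (M : kset K) (y x : K) :=
  exists s r, [/\ R s, ~ M s, R r & s * x = r * y].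

Definition tradical (A : kset K) : kset K := fun x =>
  R x /\ exists n, tspan A (x ^+ n.+1).

Lemma sub_tradical A : integral R A -> subset_k A (tradical A).
Proof. by move=> AR x Ax; split; [exact: AR|exists 0; rewrite expr1; apply: sub_tspan]. Qed.

Lemma prime_ideal_mulN P a b : prime_ideal R P -> R a -> R b -> ~ P a -> ~ P b -> ~ P (a * b).
Proof. by case=> _ _ _ pP Ra Rb Pa Pb /(pP _ _ Ra Rb)[]. Qed.

Lemma submoduleM (P : kset K) r x : submodule R P -> R r -> P x -> P (r * x).
Proof. by case=> _ _; apply. Qed.

(** This rests on [K] differing from [R]: if [l] held only zeros, every [w / x] would carry [l] into
    [R], and so every [w] would be in [R]. *)
Lemma vspan_neq0 l x : vspan l x -> x != 0 -> exists2 u, u \in l & u != 0.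
Proof.
move=> lx x0; have [_ _ _ _ [w Rw]] := domR.
apply: contrapT => l0; apply: Rw; rewrite -[w](divfK x0); apply: lx => y ly.
have [->|y0] := eqVneq y 0; first by rewrite mulr0.
by case: l0; exists y.
Qed.

Lemma acc_max (F : kset K -> Prop) N0 : acc_radical_t R ->
  F N0 -> (forall N, F N -> radical_tideal R N) ->
  exists2 N, F N & forall N', F N' -> subset_k N N' -> subset_k N' N.
Proof.
move=> acc FN0 Frad; apply: contrapT => nmax.
have nxt (X : {N | F N}) : exists Y : {N | F N},
    subset_k (sval X) (sval Y) /\ ~ subset_k (sval Y) (sval X).
  case: X => X FX; apply: contrapT => nY; apply: nmax; exists X => // Y FY XY.
  by apply: contrapT => YX; apply: nY; exists (exist _ Y FY).
have [g gP] := choice nxt.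
pose f n := sval (iter n g (exist _ N0 FN0)).
have [n|n|n /(_ n.+1 (leqnSn n))fn] := acc f; rewrite /f.
- by case: (iter _ _ _) => N /= /Frad.
- by rewrite iterS; apply: (gP _).1.
- by apply: (gP (iter n g (exist _ N0 FN0))).2 => x; apply: (fn x).1.
Qed.

(** A local form of being a finite intersection of t-primes: in a PvMD the primes inside one [M]
    form a chain, so a single prime of the list accounts for [N] in [R_M]. *)
Definition prime_cover (N : kset K) := exists Ps : seq (kset K),
  (forall P, List.In P Ps -> tprime R P /\ subset_k N P) /\
  forall M, tmax R M -> subset_k N M -> exists P, [/\ List.In P Ps, subset_k P M &
    forall x, P x -> exists s, [/\ R s, ~ M s & N (s * x)]].

(** ** Radical t-ideals of a PvMD *)

Section PvMDTheory.
Hypothesis pvmd : PvMD R.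

Lemma dvd_at_total M x y : tmax R M -> dvd_at M x y \/ dvd_at M y x.
Proof.
move=> tM; have [_ [M0 _ _] _ _ M1] := tmaxP tM.
have [->|x0] := eqVneq x 0; first by right; exists 1, 0; split; rewrite ?mulr0 ?mul0r.
have [->|y0] := eqVneq y 0; first by left; exists 1, 0; split; rewrite ?mulr0 ?mul0r.
have nz s : ~ M s -> s != 0 by move=> Ms; apply/eqP => s0; apply: Ms; rewrite s0.
have xy0 : y / x != 0 by rewrite mulf_neq0 ?invr_neq0.
have [|] := pvmd tM xy0; rewrite ?invf_div => -[a [s [Ra Rs Ms E]]]; [left|right];
  exists s, a; split=> //.
  by rewrite -[y](divfK x0) E mulrA mulrCA divff ?mulr1 // nz.
by rewrite -[x](divfK y0) E mulrA mulrCA divff ?mulr1 // nz.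
Qed.

Lemma loc_principal M a l : tmax R M -> exists y s, [/\ y \in a :: l, R s, ~ M s &
  forall u, u \in a :: l -> exists2 r, R r & s * u = r * y].
Proof.
move=> tM; have [_ _ _ _ M1] := tmaxP tM; elim: l a => [|b l IH] a.
  exists a, 1; split; rewrite ?inE // => u; rewrite inE => /eqP->; by exists 1.
have [y [s [ly Rs Ms sl]]] := IH b.
have [[t [r [Rt Mt Rr E]]]|[t [r [Rt Mt Rr E]]]] := dvd_at_total a y tM.
  exists a, (t * s); split; rewrite ?inE ?eqxx //; [exact: RM|exact: tmax_mulN|].
  move=> u; rewrite inE => /orP[/eqP->|/sl[r' Rr' E']]; first by exists (t * s); [exact: RM|].
  by exists (r' * r); [exact: RM|rewrite -mulrA E' mulrCA E mulrA].
exists y, (t * s); split; [by rewrite inE ly orbT|exact: RM|exact: tmax_mulN|].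
move=> u; rewrite inE => /orP[/eqP->|/sl[r' Rr' E']].
  by exists (s * r); [exact: RM|rewrite mulrAC E mulrC mulrA].
by exists (t * r'); [exact: RM|rewrite -mulrA E' mulrA].
Qed.

(** For the local generator [y] of [l], the element [s / y] carries [l] into [R], hence also [x];
    this gives the quotient. *)
Lemma vspan_dvd_at M l x : tmax R M -> vspan l x -> x != 0 ->
  exists2 y, y \in l & dvd_at M y x.
Proof.
move=> tM lx x0; have [u lu u0] := vspan_neq0 lx x0.
case: l lx lu => // a l lx lu.
have [y [s [ly Rs Ms sl]]] := loc_principal a l tM; exists y => //.
have [_ [M0 _ _] _ _ _] := tmaxP tM.
have y0 : y != 0.
  apply/eqP => y0; have [r _ /eqP] := sl u lu.
  by rewrite y0 mulr0 mulf_eq0 (negPf u0) orbF => /eqP s0; apply: Ms; rewrite s0.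
exists s, (s / y * x); split=> //; last by rewrite mulrAC divfK.
by apply: lx => v /sl[r Rr E]; rewrite mulrAC E mulfK.
Qed.

(** Together with [wspan_tspan], this identifies the t- and w-closures of nonzero modules. *)
Lemma tspan_wspan A : submodule R A -> subset_k (tspan A) (wspan A).
Proof.
move=> mA x [l [lA lx]] M tM; have [_ _ _ _ M1] := tmaxP tM.
have [x0|x0] := eqVneq x 0.
  by exists 1; split=> //; rewrite x0 mulr0; case: mA.
have [y /lA Ay [s [r [Rs Ms Rr E]]]] := vspan_dvd_at tM lx x0.
by exists s; split=> //; rewrite E; apply: submoduleM.
Qed.

Lemma integrally_closed x n : R (x ^+ n.+1) -> R x.
Proof.
move=> Rx; apply: wspan_R => M tM.
have [[s [r [Rs Ms Rr E]]]|[s [r [Rs Ms Rr]]]] := dvd_at_total 1 x tM.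
  by exists s; split=> //; rewrite E mulr1.
(* Here [s = r * x], so [s ^+ n * x = r ^+ n * x ^+ n.+1]. *)
rewrite mulr1 => E; exists (s ^+ n); split; [exact: RX|exact: tmax_expN|].
by rewrite E exprMn -mulrA -exprSr; apply/RM => //; apply: RX.
Qed.

(** A prime of a valuation domain is unchanged by localizing at it: [P R_P = P R_M]. *)
Lemma prime_loc M P x s : tmax R M -> prime_ideal R P -> subset_k P M ->
  P x -> R s -> ~ P s -> exists t, [/\ R t, ~ M t & P (t * (x / s))].
Proof.
move=> tM [mP PR _ pP] PM Px Rs Ps.
have s0 : s != 0 by apply/eqP => s0; apply: Ps; rewrite s0; case: mP.
have [[t [r [Rt Mt Rr E]]]|[t [r [Rt Mt Rr E]]]] := dvd_at_total 1 (x / s) tM.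
  exists t; split=> //; rewrite mulr1 in E.
  have : P (s * (t * (x / s))) by rewrite mulrCA (mulrC s) divfK //; apply: submoduleM.
  by rewrite E => /(pP _ _ Rs Rr)[].
have /(pP _ _ Rt Rs)[/PM//|//] : P (t * s).
by rewrite -[t]mulr1 E -mulrA divfK //; apply: submoduleM.
Qed.

Lemma prime_chain M P Q : tmax R M -> prime_ideal R P -> prime_ideal R Q ->
  subset_k P M -> subset_k Q M -> subset_k P Q \/ subset_k Q P.
Proof.
move=> tM [mP PR _ pP] [mQ QR _ pQ] PM QM; apply: contrapT => /not_orP[nPQ nQP].
have [p Pp Qp] : exists2 p, P p & ~ Q p.
  by apply: contrapT => h; apply: nPQ => x Px; apply: contrapT => Qx; apply: h; exists x.
have [q Qq Pq] : exists2 q, Q q & ~ P q.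
  by apply: contrapT => h; apply: nQP => x Qx; apply: contrapT => Px; apply: h; exists x.
have [[s [r [Rs Ms Rr E]]]|[s [r [Rs Ms Rr E]]]] := dvd_at_total p q tM.
  have /(pP _ _ Rs (QR _ Qq))[/PM|] : P (s * q) by rewrite E; apply: submoduleM.
  - by [].
  - by [].
have /(pQ _ _ Rs (PR _ Pp))[/QM|] : Q (s * p) by rewrite E; apply: submoduleM.
- by [].
- by [].
Qed.

(** At each [M] some [y] of [l] divides [x], so its powers divide those of [x]; an exponent that
    serves all of [l] therefore serves [x]. *)
Lemma tradical_vspan A l x : (forall y, y \in l -> tradical A y) ->
  vspan l x -> tradical A x.
Proof.
move=> lA lx; have Rx : R x by apply: vspan_integral lx => y /lA[].
split=> //; have [n ln] : exists n, forall y, y \in l -> tspan A (y ^+ n.+1).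
  elim: l lA {lx} => [|a l IH] lA; first by exists 0.
  have [|n ln] := IH; first by move=> y ly; apply: lA; rewrite inE ly orbT.
  have [|Ra [m am]] := lA a; first by rewrite inE eqxx.
  have [_ _ tM] := tspan_submodule A.
  exists (n + m)%N => y; rewrite inE => /orP[/eqP->|ly].
    by rewrite -addnS exprD; apply: tM => //; apply: RX.
  rewrite -addSn exprD mulrC; apply: tM; last exact: ln.
  by apply: RX; case: (lA y); rewrite // inE ly orbT.
exists n; have [l' [l'A l'l]] := tspan_seq (g := fun y => y ^+ n.+1) ln.
exists l'; split=> // z zl'; apply: wspan_R => M tM.
have [_ _ _ _ M1] := tmaxP tM.
have [->|x0] := eqVneq x 0; first by exists 1; split; rewrite // expr0n !mulr0.
have [y ly [s [r [Rs Ms Rr E]]]] := vspan_dvd_at tM lx x0.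
exists (s ^+ n.+1); split; [exact: RX|exact: tmax_expN|].
by rewrite mulrCA -exprMn E exprMn mulrCA; apply: RM; [exact: RX|exact: l'l].
Qed.

Lemma tradical_radical_tideal A : integral R A -> nonzero_set A ->
  radical_tideal R (tradical A).
Proof.
move=> AR [a [Aa a0]]; have tR : integral R (tradical A) by move=> x [].
split=> //; last first.
  move=> x n Rx [_ [m]]; rewrite -exprM mulnS addSn => tx.
  by split=> //; exists (n + n.+1 * m)%N.
apply/tideal_integralP => //; split.
- split.
  + by apply: (@tradical_vspan _ [::]) => // z _; rewrite mulr0.
  + move=> x y tx ty; apply: (@tradical_vspan _ [:: x; y]).
      by move=> z; rewrite !inE => /orP[]/eqP->.
    by move=> z zl; rewrite mulrDr; apply: RD; apply: zl; rewrite !inE eqxx ?orbT.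
  + move=> r x Rr tx; apply: (@tradical_vspan _ [:: x]).
      by move=> z; rewrite !inE => /eqP->.
    by apply: vspan_mulR => //; apply: mem_vspan; rewrite inE.
- by exists a; split=> //; apply: sub_tradical.
- by move=> x [l [lA]]; apply: tradical_vspan.
Qed.

(** Among the radicals of finite subsets of [N] one is maximal, and adjoining any [x] of [N] cannot
    enlarge it. Keeping [a] in the list makes these radicals nonzero. *)
Lemma radical_tideal_rad_fingen N : acc_radical_t R -> radical_tideal R N ->
  rad_fingen N.
Proof.
move=> acc [NR /(tideal_integralP NR)[mN [a [Na a0]] Nt] Nrad].
pose F X := exists l : seq K, [/\ forall y, y \in l -> N y, a \in l &
  X = tradical (fun y => y \in l)].
have [||X [l [lN la ->]] maxl] := @acc_max F (tradical (fun y => y \in [:: a])) acc.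
- exists [:: a]; split; rewrite ?inE // => y; by rewrite inE => /eqP->.
- move=> X [l [lN la ->]]; apply: tradical_radical_tideal; last by exists a.
  by move=> y /lN/NR.
exists l; split=> // x Nx.
have [|||_ [n [l' [l'l l'x]]]] := maxl (tradical (fun y => y \in x :: l)) _ _ x.
- exists (x :: l); split; rewrite ?inE ?la ?orbT // => y.
  by rewrite inE => /orP[/eqP->|/lN].
- move=> y [Ry [n ty]]; split=> //; exists n; apply: tspan_mono ty => u lu.
  by rewrite inE lu orbT.
- by apply: sub_tradical; [move=> y; rewrite inE => /orP[/eqP->|/lN]; apply: NR|rewrite inE eqxx].
- by exists n; apply: (vspan_trans _ l'x) => y /l'l; apply: mem_vspan.
Qed.

(** Noetherian induction: a maximal counterexample is not prime, so it is the intersection of two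
    larger radical t-ideals [N1] and [N2], whose covers combine. *)
Lemma radical_tideal_prime_cover N : acc_radical_t R -> radical_tideal R N ->
  prime_cover N.
Proof.
move=> acc rN; apply: contrapT => ncN.
pose F X := radical_tideal R X /\ ~ prime_cover X.
have [||{ncN rN}N [rN ncN] maxN] := @acc_max F N acc; first by split.
  by move=> X [].
have [NR tN Nrad] := rN; have [mN [n0 [Nn0 n0n]] Nt] := (tideal_integralP NR).1 tN.
apply: ncN; have [pN|npN] := pselect (Defs.proper R N); last first.
  exists [::]; split=> // M /tmaxP[_ _ _ _ M1] NM; case: M1; apply: NM.
  by apply: contrapT => /(properP mN NR).
have [primeN|] := pselect (forall a b, R a -> R b -> N (a * b) -> N a \/ N b).
  exists [:: N]; split; first by move=> P [<-|//]; split.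
  move=> M /tmaxP[_ _ _ _ M1] NM; exists N; split=> //; first by left.
  by move=> x Nx; exists 1; split=> //; rewrite mul1r.
move/existsNP => [a /existsNP[b /not_implyP[Ra /not_implyP[Rb /not_implyP[Nab]]]]].
move/not_orP => [Na Nb].
have radadj c : R c -> radical_tideal R (tradical (adjoin N c)).
  move=> Rc; apply: tradical_radical_tideal; first exact: adjoin_integral.
  by exists n0; split=> //; apply: sub_adjoin.
have key c : R c -> ~ N c -> prime_cover (tradical (adjoin N c)).
  move=> Rc Nc; apply: contrapT => nc; apply: Nc.
  have aR : integral R (adjoin N c) by apply: adjoin_integral.
  apply: (maxN (tradical (adjoin N c))); first by split=> //; apply: radadj.
  - by move=> x Nx; apply: sub_tradical => //; apply: sub_adjoin.
  - by apply: sub_tradical => //; apply: adjoin_mem.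
have [[Ps [PsP PsM]] [Qs [QsP QsM]]] := (key a Ra Na, key b Rb Nb).
set N1 := tradical (adjoin N a) in PsP PsM; set N2 := tradical (adjoin N b) in QsP QsM.
have NN1 : subset_k N N1.
  by move=> x Nx; apply: sub_tradical; [exact: adjoin_integral|exact: sub_adjoin].
have NN2 : subset_k N N2.
  by move=> x Nx; apply: sub_tradical; [exact: adjoin_integral|exact: sub_adjoin].
have NI x : N1 x -> N2 x -> N x.
  move=> [Rx [n xn]] [_ [m xm]]; apply: (Nrad x (n + m.+1)%N Rx).
  rewrite -addSn exprD; apply: Nt; apply: tspan_mul xn xm => u v; exact: adjoin_mul.
have mN1 : submodule R N1 by have [R1i /(tideal_integralP R1i)[]] := radadj a Ra.
have mN2 : submodule R N2 by have [R2i /(tideal_integralP R2i)[]] := radadj b Rb.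
exists (Ps ++ Qs); split.
  move=> P /(@List.in_app_or _ _ _ _)[/PsP|/QsP] [tP sub]; split=> // x Nx.
    exact/sub/NN1.
  exact/sub/NN2.
move=> M tM NM; have [MR mM _ _ M1] := tmaxP tM.
have inl P : List.In P Ps -> List.In P (Ps ++ Qs) by move=> h; apply: List.in_or_app; left.
have inr P : List.In P Qs -> List.In P (Ps ++ Qs) by move=> h; apply: List.in_or_app; right.
have nsub A : ~ subset_k A M -> exists2 v, A v & ~ M v.
  by move=> h; apply: contrapT => h'; apply: h => v Av; apply: contrapT => Mv; apply: h'; exists v.
(* An element of [N1] outside [M] makes [N] and [N2] agree at [M], so the cover of [N2] applies; the
   other case is symmetric. *)
have [N1M|/nsub[v N1v Mv]] := pselect (subset_k N1 M); last first.
  have [N2M|/nsub[u N2u Mu]] := pselect (subset_k N2 M); last first.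
    case: (tmax_mulN tM N1v.1 N2u.1 Mv Mu); apply/NM/NI; last exact: submoduleM N1v.1 _.
    by rewrite mulrC; apply: submoduleM N2u.1 _.
  have [Q [/inr Qin QM Qloc]] := QsM M tM N2M; exists Q; split=> // x /Qloc[s [Rs Ms N2s]].
  exists (v * s); split; [exact: RM N1v.1 _|exact: tmax_mulN N1v.1 _ _ _|].
  rewrite -mulrA; apply: NI; last exact: submoduleM N1v.1 _.
  by rewrite mulrC; apply: submoduleM => //; apply: N2s.1.
have [P [Pin PM Ploc]] := PsM M tM N1M.
have [N2M|/nsub[u N2u Mu]] := pselect (subset_k N2 M); last first.
  exists P; split=> // [|x /Ploc[s [Rs Ms N1s]]]; first exact: inl.
  exists (u * s); split; [exact: RM N2u.1 _|exact: tmax_mulN N2u.1 _ _ _|].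
  rewrite -mulrA; apply: NI; first exact: submoduleM N2u.1 _.
  by rewrite mulrC; apply: submoduleM => //; apply: N1s.1.
have [Q [Qin QM Qloc]] := QsM M tM N2M.
have loc x : P x -> Q x -> exists s, [/\ R s, ~ M s & N (s * x)].
  move=> /Ploc[s [Rs Ms N1s]] /Qloc[t [Rt Mt N2t]].
  exists (s * t); split; [exact: RM|exact: tmax_mulN|].
  by apply: NI; [rewrite mulrAC mulrC|rewrite -mulrA]; apply: submoduleM.
(* The smaller of the two comparable primes agrees at [M] with the intersection [N]. *)
have [PQ|QP] := prime_chain tM (PsP P Pin).1.1 (QsP Q Qin).1.1 PM QM.
  by exists P; split=> // [|x Px]; [exact: inl|apply: loc => //; apply: PQ].
by exists Q; split=> // [|x Qx]; [exact: inr|apply: loc => //; apply: QP].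
Qed.

(** ** Strong discreteness *)

Lemma tprime_generator P : strongly_discrete R -> tprime R P ->
  exists2 p, P p & forall x, P x -> dvd_at P p x.
Proof.
move=> [_ sd] tP; have [[mP PR pP primeP] tidP] := tP.
have [_ [p [Pp p0]] Pt] := (tideal_integralP PR).1 tidP.
have P1 : ~ P 1 by apply/(properP mP PR).
have mPP : submodule R (mulmod P P) by apply: mulmod_submodule.
have nPP : nonzero_set (mulmod P P).
  by exists (p * p); split; [exact: mem_mulmod|rewrite mulf_neq0].
have sPP : subset_k (mulmod P P) P.
  by apply: mulmod_sub => // a b /PR Ra; apply: submoduleM.
have [x Px nx] : exists2 x, P x & ~ wspan (mulmod P P) x.
  apply: contrapT => h; apply: (sd P tP) => x; split.
    by move/(tclE mPP nPP)/(tspan_mono sPP)/Pt.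
  move=> Px; apply/(tclE mPP nPP)/wspan_tspan => //; apply: contrapT => nx; apply: h.
  by exists x.
(* At this [M], [x] is outside [P^2 R_M]. If [y] divides [x] there, the quotient is outside [P],
   hence a unit of [R_P]. *)
have [M [tM nM]] : exists M, tmax R M /\
    forall s, R s -> ~ M s -> ~ mulmod P P (s * x).
  apply: contrapT => h; apply: nx => M tM; apply: contrapT => h'; apply: h.
  by exists M; split=> // s Rs Ms Hs; apply: h'; exists s.
have PM : subset_k P M.
  by move=> s Ps; apply: contrapT => /(nM s (PR s Ps)); apply; apply: mem_mulmod.
exists x => // y Py.
have [[s [r [Rs Ms Rr E]]]|[s [r [Rs Ms Rr E]]]] := dvd_at_total x y tM.
  by exists s, r; split=> // /PM.
have [Pr|Pr] := pselect (P r); last by exists r, s.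
by case: (nM s Rs Ms); rewrite E; apply: mem_mulmod.
Qed.

(** [N] and [P] extend to the same ideal of [R_M], [a] generates the extension
    of [P] to [R_P], and the unit [t] of [R_M] clears the denominators of [a^-1 l]. *)
Definition local_data (N : kset K) (l : seq K) (M P : kset K) (a t : K) :=
  [/\ tprime R P, subset_k N P, subset_k P M &
     forall x, P x -> exists s, [/\ R s, ~ M s & N (s * x)]] /\
  [/\ a \in l, a != 0, forall x, P x -> dvd_at P a x &
     [/\ R t, ~ M t & forall y, y \in l -> R (t / a * y)]].

Lemma local_generators N : strongly_discrete R -> acc_radical_t R ->
  radical_tideal R N ->
  exists (Ps : seq (kset K)) (l : seq K),
  [/\ forall y, y \in l -> N y, forall x, N x -> exists n, vspan l (x ^+ n.+1) &
    forall M, tmax R M -> subset_k N M ->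
      exists P a t, List.In P Ps /\ local_data N l M P a t].
Proof.
move=> sd acc rN; have [NR /(tideal_integralP NR)[mN _ _] _] := rN.
have [Ps [PsP PsM]] := radical_tideal_prime_cover acc rN.
have [l1 [l1N l1rad]] := radical_tideal_rad_fingen acc rN.
have [l0 [l0N l0P]] : exists l0 : seq K, (forall y, y \in l0 -> N y) /\
    forall P, List.In P Ps -> (forall x, P x -> exists s, [/\ R s, ~ P s & N (s * x)]) ->
    exists2 a, a \in l0 & forall x, P x -> dvd_at P a x.
  elim: Ps PsP {PsM} => [|Q Qs IH] PsP; first by exists [::].
  have [P QsP|l0 [l0N l0P]] := IH; first by apply: PsP; right.
  have [[primeQ tQ] _] := PsP Q (or_introl erefl).
  have [p Qp pgen] := tprime_generator sd (conj primeQ tQ).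
  (* Only primes that agree with [N] at themselves need a generator; for them a multiple [s * p]
     with [s] outside [Q] lies in [N] and still generates [Q R_Q]. *)
  have [Qloc|nQloc] := pselect (forall x, Q x -> exists s, [/\ R s, ~ Q s & N (s * x)]);
    last by exists l0; split=> // P [<- /nQloc|/l0P].
  have [s [Rs Qs' Nsp]] := Qloc p Qp.
  exists (s * p :: l0); split; first by move=> y; rewrite inE => /orP[/eqP->|/l0N].
  move=> P [<- _|QsP' /(l0P P QsP')[a l0a Pa]]; last first.
    by exists a; rewrite // inE l0a orbT.
  exists (s * p); first by rewrite inE eqxx.
  move=> x /pgen[s' [r [Rs' Qs'' Rr E]]].
  exists (s * s'), r; split=> //; [exact: RM|exact: prime_ideal_mulN|].
  by rewrite -mulrA E mulrCA.
exists Ps, (l1 ++ l0); split.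
- by move=> y; rewrite mem_cat => /orP[/l1N|/l0N].
- move=> x /l1rad[n l1x]; exists n; apply: (vspan_sub _ l1x) => y l1y.
  by rewrite mem_cat l1y.
- move=> M tM NM; have [P [Pin PM Ploc]] := PsM M tM NM.
  have [tP NP] := PsP P Pin; have [[mP PR pP _] tidP] := tP.
  have [_ [p [Pp p0]] _] := (tideal_integralP PR).1 tidP.
  have [|a0 l0a0 a0gen] := l0P P Pin.
    by move=> x /Ploc[s [Rs Ms Ns]]; exists s; split=> // /PM.
  have la0 : a0 \in l1 ++ l0 by rewrite mem_cat l0a0 orbT.
  case: (l1 ++ l0) la0 => // b l la0.
  (* The local generator [a] of the whole list divides [a0], so it still generates [P R_P], and
     [s / a] carries the list into [R]. *)
  have [a [s [la Rs Ms sl]]] := loc_principal b l tM.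
  have [r0 Rr0 E0] := sl a0 la0.
  have agen x : P x -> dvd_at P a x.
    move=> /a0gen[s' [r [Rs' Ps' Rr E]]]; exists (s * s'), (r * r0); split.
    - exact: RM.
    - by apply: prime_ideal_mulN => //; [case: tP|move/PM].
    - exact: RM.
    - by rewrite -mulrA E mulrCA E0 mulrA.
  have a0' : a != 0.
    apply/eqP => a0'; have [s' [r [_ Ps' _ /eqP]]] := agen p Pp.
    rewrite a0' mulr0 mulf_eq0 (negPf p0) orbF => /eqP s'0; apply: Ps'.
    by rewrite s'0; case: mP.
  exists P, a, s; do !split=> //.
  by move=> y /sl[r Rr E]; rewrite mulrAC E mulfK.
Qed.

(** * Multipliers of the local generators of a radical t-ideal *)

Section LocalGenerators.
Variables (N : kset K) (Ps : seq (kset K)) (l : seq K).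
Hypothesis rN : radical_tideal R N.
Hypothesis lN : forall y, y \in l -> N y.
Hypothesis lrad : forall x, N x -> exists n, vspan l (x ^+ n.+1).
Hypothesis Ndata : forall M, tmax R M -> subset_k N M ->
  exists P a t, List.In P Ps /\ local_data N l M P a t.

Let NR : integral R N. Proof. by case: rN. Qed.
Let mN : submodule R N. Proof. by case: rN => _ /(tideal_integralP NR)[]. Qed.
Let Nw : subset_k (wspan N) N.
Proof.
case: rN => _ /(tideal_integralP NR)[_ nN Nt] _ x wx; apply: Nt.
exact: wspan_tspan.
Qed.

(** Settles the [M] not containing [N]: the power of [b] is a unit of [R_M] that every multiplier of
    [l] into [R] sends into [R]. *)
Let Npow M : tmax R M -> ~ subset_k N M ->
  exists b n, [/\ N b, ~ M b, ~ M (b ^+ n.+1) & vspan l (b ^+ n.+1)].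
Proof.
move=> tM NM; have [b Nb Mb] : exists2 b, N b & ~ M b.
  by apply: contrapT => h; apply: NM => b Nb; apply: contrapT => Mb; apply: h; exists b.
have [n ln] := lrad Nb; exists b, n; split=> //.
by apply: tmax_expN => //; apply: NR.
Qed.

(** At [M] containing [N], write [g = r * a / s] with [s] outside [P]; then [u * a] is integral and
    [h / s] lies in [P R_P = P R_M = N R_M]. *)
Lemma inv_mul_radical u g h : (forall y, y \in l -> R (u * y)) ->
  N g -> N h -> N (u * g * h).
Proof.
move=> ul Ng Nh; apply: Nw => M tM; have [NM|NM] := pselect (subset_k N M).
  have [P [a [t [_ [[[primeP _] NP PM Ploc] [la a0 agen _]]]]]] := Ndata tM NM.
  have [s [r [Rs Ps' Rr E]]] := agen g (NP g Ng).
  have [s1 [Rs1 Ms1 P1]] := prime_loc tM primeP PM (NP h Nh) Rs Ps'.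
  have [s2 [Rs2 Ms2 N2]] := Ploc _ P1.
  exists (s2 * s1); split; [exact: RM|exact: tmax_mulN|].
  have s0 : s != 0 by apply/eqP => s0; apply: Ps'; rewrite s0; case: primeP => -[].
  have -> : s2 * s1 * (u * g * h) = (u * a * r) * (s2 * (s1 * (h / s))).
    have -> : g = r * a / s by rewrite -E mulrC mulKf.
    by field.
  by apply: submoduleM => //; apply: RM => //; apply: ul.
have [b [n [Nb Mb Mbn lb]]] := Npow tM NM.
exists (b ^+ n.+1); split=> //; first by apply/RX/NR.
rewrite mulrA; apply: submoduleM => //.
by rewrite mulrA (mulrC _ u); apply: RM; [apply: lb|apply: NR].
Qed.

(** Up to a unit of [R_M], [1 / x] is the product of [t / a], which carries [l] into [R], and
    [a / x], which lies in [P R_P = N R_M]; so [inv_mul_radical] applies. *)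
Lemma local_inverse_end M P a t x : tmax R M -> local_data N l M P a t ->
  R x -> ~ P x ->
  exists q, [/\ R q, ~ M q & forall g, N g -> N (q / x * g)].
Proof.
move=> tM [[[primeP _] NP PM Ploc] [la a0 agen [Rt Mt tl]]] Rx Px.
have Pa : P a by apply/NP/lN.
have [s1 [Rs1 Ms1 P1]] := prime_loc tM primeP PM Pa Rx Px.
have [s2 [Rs2 Ms2 N2]] := Ploc _ P1.
exists (t * (s2 * s1)); split; [by do !apply: RM|by do !apply: tmax_mulN => //; apply: RM|].
have x0 : x != 0 by apply/eqP => x0; apply: Px; rewrite x0; case: primeP => -[].
move=> g Ng; have -> : t * (s2 * s1) / x * g = t / a * (s2 * (s1 * (a / x))) * g.
  by field; rewrite x0 a0.
exact: inv_mul_radical.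
Qed.

(* [c] lies in every prime of [Ps] that is not contained in [M]; one that is
   contained in [M] and agrees with [N] at some [M'] must be [P], because [P]
   agrees with [N] at [M]. *)
Lemma separating_element M P a t : tmax R M -> local_data N l M P a t ->
  exists c, [/\ R c, ~ M c & forall M' P' a' t', tmax R M' -> List.In P' Ps ->
    local_data N l M' P' a' t' -> P' c \/ seteq P P'].
Proof.
move=> tM [[[primeP _] NP PM Ploc] _].
have [_ _ _ _ M1] := tmaxP tM.
have [c [Rc Mc cP]] : exists c, [/\ R c, ~ M c &
    forall Q, List.In Q Ps -> prime_ideal R Q -> Q c \/ subset_k Q M].
  elim: (Ps) => [|Q Qs [c [Rc Mc cP]]]; first by exists 1.
  have [[d Qd Md]|h] := pselect (exists2 d, Q d & ~ M d); last first.
    exists c; split=> // Q' [<- _|/cP//]; right=> x Qx; apply: contrapT => Mx; apply: h.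
    by exists x.
  have [[mQ QR _ _]|npQ] := pselect (prime_ideal R Q); last first.
    by exists c; split=> // Q' [<- /npQ|/cP].
  exists (d * c); split; [by apply: RM; first exact: QR|by apply: tmax_mulN => //; apply: QR|].
  move=> Q' [<- _|/cP h pQ']; first by left; rewrite mulrC; apply: submoduleM.
  have [mQ' _ _ _] := pQ'.
  by have [Q'c|] := h pQ'; [left; apply: submoduleM => //; apply: QR|right].
exists c; split=> // M' P' a' t' tM' P'in [[[primeP' _] NP' PM' Ploc'] _].
have [|P'M] := cP P' P'in primeP'; [by left|right=> x].
(* If [B] agrees with [N] at [B'], every prime between [N] and [B'] contains [B]. *)
have sub A B B' y : tmax R B' -> prime_ideal R A -> subset_k N A -> subset_k A B' ->
    (forall x, B x -> exists s, [/\ R s, ~ B' s & N (s * x)]) -> R y -> B y -> A y.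
  move=> tB' [_ _ _ primeA] NA AB' Bloc Ry /Bloc[s [Rs Bs /NA]].
  by case/(primeA _ _ Rs Ry) => // /AB'.
split=> [Px|P'x].
  by apply: (sub P' P M) => //; case: primeP => _ + _ _; apply.
apply: (sub P P' M') => //; last by case: primeP' => _ + _ _; apply.
move=> y Py; apply: PM'; apply: (sub P' P M) => //.
by case: primeP => _ + _ _; apply.
Qed.

(** If the prime [P] attached to [M] contains [c], then [c / s] lies in [P R_M] and absorbs the
    denominator of [g]. Only primes avoiding [c] remain to be checked. *)
Let tame_loc M u c g : tmax R M -> (forall y, y \in l -> R (u * y)) -> R c -> N g ->
  (forall P a t, List.In P Ps -> local_data N l M P a t -> P c \/
     exists s, [/\ R s, ~ M s & R (s * (c * u * g))]) ->
  exists s, [/\ R s, ~ M s & R (s * (c * u * g))].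
Proof.
move=> tM ul Rc Ng cP; have [NM|NM] := pselect (subset_k N M); last first.
  have [b [n [Nb Mb Mbn lb]]] := Npow tM NM.
  exists (b ^+ n.+1); split=> //; first by apply/RX/NR.
  have -> : b ^+ n.+1 * (c * u * g) = (c * g) * (u * b ^+ n.+1) by ring.
  by apply: RM; [apply: RM => //; apply: NR|apply: lb].
have [P [a [t [Pin D]]]] := Ndata tM NM.
have [Pc|//] := cP P a t Pin D.
have [[[primeP _] NP PM Ploc] [la a0 agen _]] := D.
have [s [r [Rs Ps' Rr E]]] := agen g (NP g Ng).
have [s1 [Rs1 Ms1 P1]] := prime_loc tM primeP PM Pc Rs Ps'.
exists s1; split=> //.
have s0 : s != 0 by apply/eqP => s0; apply: Ps'; rewrite s0; case: primeP => -[].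
have -> : s1 * (c * u * g) = (s1 * (c / s)) * ((u * a) * r).
  have -> : g = r * a / s by rewrite -E mulrC mulKf.
  by field.
by apply: RM; [case: primeP => _ + _ _; apply|apply: RM => //; apply: ul].
Qed.

Lemma radical_tideal_vcl : subset_k (vcl R N) N.
Proof.
move=> x vx; have Rx : R x by rewrite -[x]mulr1; apply: vx => b /NR; rewrite mul1r.
apply: Nw => M tM; have [NM|NM] := pselect (subset_k N M); last first.
  have [b [n [Nb Mb _ _]]] := Npow tM NM.
  by exists b; split=> //; [exact: NR|rewrite mulrC; apply: submoduleM].
have [P [a [t [Pin D]]]] := Ndata tM NM.
have [[tP NP PM Ploc] [la a0 agen [Rt Mt tl]]] := D.
apply: Ploc; apply: contrapT => Px; have [primeP _] := tP.
have [mP PR _ _] := primeP; have [MR mM _ _ _] := tmaxP tM.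
have nz y : ~ P y -> y != 0 by move=> Py; apply/eqP => y0; apply: Py; rewrite y0; case: mP.
(* If [P] is strictly inside [M], then [q / (x * c)] maps [N] into itself, so [q / c] is integral
   and [q] falls in [M], a contradiction. *)
have [[c Mc Pc]|h] := pselect (exists2 c, M c & ~ P c).
  have Rc := MR c Mc.
  have [||q [Rq Mq qN]] := local_inverse_end (x := x * c) tM D; first exact: RM.
    exact: prime_ideal_mulN.
  apply: Mq; have /vx : colon R N (q / (x * c)) by move=> g /qN/NR.
  have -> : x * (q / (x * c)) = q / c by field; rewrite !nz.
  by move=> Rqc; rewrite -[q](divfK (nz c Pc)); apply: submoduleM.
(* If [P = M], then [P] is attached to no other maximal t-ideal, so [c * (t / a)] carries [N] into
   [R]; this puts [x * (c * t)] in [P], a contradiction. *)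
have MP : subset_k M P.
  by move=> y My; apply: contrapT => Py; apply: h; exists y.
have [c [Rc Mc cP]] := separating_element tM D.
have /vx Rxz : colon R N (c * (t / a)).
  move=> g Ng; apply: wspan_R => M' tM'; apply: tame_loc => // P' a' t' P'in D'.
  have [|PP'] := cP M' P' a' t' tM' P'in D'; [by left|right].
  have [[_ _ P'M' _] _] := D'.
  have MM' : subset_k M M' by move=> y /MP/PP'/P'M'.
  have M'M : subset_k M' M.
    move=> y; case: tM => _ _ _ maxM; case: tM' => M'R M'p M't _.
    by move/(maxM M' M'R M'p M't MM').
  have [s [r [Rs Ps' Rr E]]] := agen g (NP g Ng).
  exists s; split=> // [/M'M/MP//|].
  have -> : s * (c * (t / a) * g) = c * t * (s * g) / a by field.
  by rewrite E mulrA mulfK //; apply: RM => //; apply: RM.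
have Pt : ~ P t by move/PM.
have Pc : ~ P c by move/PM.
apply: (prime_ideal_mulN primeP Rx _ Px (prime_ideal_mulN primeP Rc Rt Pc Pt)); first exact: RM.
have -> : x * (c * t) = x * (c * (t / a)) * a by field.
by apply: submoduleM => //; apply/NP/lN.
Qed.

(** Applied to [H = I (R : I)]. Some [s * a] with [s] outside [P] lies in [H], and [q / s] preserves
    [H] for some [q] outside [M]; then [t / a] sends [q * a] to [t * q], a unit of [R_M]. *)
Lemma trace_inverse H M : submodule R H -> subset_k H N ->
  (forall u g, (forall h, H h -> R (u * h)) -> N g -> N (u * g)) ->
  (forall u h, (forall h, H h -> R (u * h)) -> H h -> H (u * h)) ->
  tmax R M -> subset_k N M ->
  exists u h, [/\ forall y, y \in l -> R (u * y), H h, R (u * h) & ~ M (u * h)].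
Proof.
move=> mH HN Hend HH tM NM; have [P [a [t [Pin D]]]] := Ndata tM NM.
have [[tP NP PM Ploc] [la a0 agen [Rt Mt tl]]] := D.
have [primeP _] := tP; have [mP PR _ _] := primeP.
have Pt : ~ P t by move/PM.
have [s [Rs Ps' Hsa]] : exists s, [/\ R s, ~ P s & H (s * a)].
  (* Otherwise [c t / a] belongs to [(R : H)], hence maps [a] into [N]; but [c t]
     is not in [P]. *)
  apply: contrapT => noS; have [c [Rc Mc cP]] := separating_element tM D.
  have Pc : ~ P c by move/PM.
  have zH h : H h -> R (c * (t / a) * h).
    move=> Hh; have Nh := HN h Hh.
    apply: wspan_R => M' tM'; apply: tame_loc => // P' a' t' P'in D'.
    have [|PP'] := cP M' P' a' t' tM' P'in D'; [by left|right].
    have PM' : subset_k P M' by have [[_ _ P'M' _] _] := D'; move=> y /PP'/P'M'.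
    have [s [r [Rs Ps' Rr E]]] := agen h (NP h Nh).
    have Pr : P r.
      apply: contrapT => Pr; apply: noS; exists r; split=> //.
      by rewrite -E; apply: submoduleM.
    have [s1 [Rs1 Ms1 P1]] := prime_loc tM' primeP PM' Pr Rs Ps'.
    exists s1; split=> //.
    have s0 : s != 0 by apply/eqP => s0; apply: Ps'; rewrite s0; case: mP.
    have -> : s1 * (c * (t / a) * h) = (c * t) * (s1 * (r / s)).
      have -> : h = r * a / s by rewrite -E mulrC mulKf.
      by field; rewrite s0 a0.
    by apply: RM; [exact: RM|exact: PR].
  have := NP _ (Hend _ a zH (lN la)).
  have -> : c * (t / a) * a = c * t by field.
  exact: prime_ideal_mulN.
have [q [Rq Mq qN]] := local_inverse_end tM D Rs Ps'.
have Hqa : H (q * a).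
  have s0 : s != 0 by apply/eqP => s0; apply: Ps'; rewrite s0; case: mP.
  have -> : q * a = q / s * (s * a) by field.
  by apply: HH => // h /HN/qN/NR.
exists (t / a), (q * a); have -> : t / a * (q * a) = t * q by field.
by split=> //; [exact: RM|exact: tmax_mulN].
Qed.

End LocalGenerators.

(** * Divisorial ideals and w-stability *)

Lemma radical_tideal_divisorial N : strongly_discrete R -> acc_radical_t R ->
  radical_tideal R N -> divisorial R N.
Proof.
move=> sd acc rN; have [Ps [l [lN lrad Ndata]]] := local_generators sd acc rN.
have [NR [fN _] _] := rN; split=> // x; split; last exact: radical_tideal_vcl Ndata _.
by move=> Nx b /(_ x Nx); rewrite mulrC.
Qed.

Lemma divisorial_wstable I : strongly_discrete R -> acc_radical_t R ->
  divisorial_ideal R I -> wstable R I.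
Proof.
move=> sd acc [IR [fI vI]]; have [mI [i0 [Ii0 i00]] _] := fI.
pose L := colon R I; pose H := mulmod I L.
have mH : submodule R H by apply: mulmod_submodule.
have HR : integral R H.
  by apply: mulmod_sub; [exact: submodule_self|move=> a b Ia /(_ a Ia); rewrite mulrC].
have L1 : L 1 by move=> b /IR; rewrite mul1r.
have nH : nonzero_set H.
  by exists i0; split=> //; rewrite -[i0]mulr1; apply: mem_mulmod.
(* [u I] is carried into [R] by [(R : I)], so it lies in [I_v = I]. *)
have endI u : (forall h, H h -> R (u * h)) -> Eend I u.
  move=> uH i Ii; apply/vI => b Lb; rewrite -mulrA; apply: uH.
  exact: mem_mulmod.
have endH u h : Eend I u -> H h -> H (u * h).
  move=> Iu; apply: mulmod_scale => // i b Ii Lb; rewrite mulrA.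
  by apply: mem_mulmod => //; apply: Iu.
have HN := sub_tradical HR; set N := tradical H in HN.
have rN : radical_tideal R N by apply: tradical_radical_tideal.
(* [u] preserves [H], so a power of [u * g] lies in [H_t]; then [u * g] is itself integral because
   [R] is closed under roots. *)
have endN u g : (forall h, H h -> R (u * h)) -> N g -> N (u * g).
  move=> uH [Rg [n tg]].
  have tug : tspan H ((u * g) ^+ n.+1).
    by rewrite exprMn; apply: tspan_expr tg => h; apply/endH/endI.
  split; last by exists n.
  exact: integrally_closed (tspan_integral HR tug).
have [Ps [l [lN lrad Ndata]]] := local_generators sd acc rN.
have Iw : subset_k (wspan I) I.
  move=> x wx; apply/vI => b Lb; apply: wspan_R => M /wx[s [Rs Ms Isx]].
  by exists s; split=> //; rewrite mulrA mulrC; apply: Lb.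
have sub_w A : subset_k A (wspan A).
  move=> x Ax M /tmaxP[_ _ _ _ M1]; exists 1; split=> //; by rewrite mul1r.
split.
  split=> // x; split; first by move=> Ix; apply/(wclE mI)/sub_w.
  by move/(wclE mI)/Iw.
pose Y := colon (Eend I) I; pose H' := mulmod I Y.
have mH' : submodule R H' by apply: mulmod_submodule.
have mT : submodule R (Eend I).
  have [I0 ID IM] := mI; split.
  - by move=> i Ii; rewrite mul0r.
  - by move=> u v Tu Tv i Ii; rewrite mulrDl; apply: ID; [exact: Tu|exact: Tv].
  - by move=> r u Rr Tu i Ii; rewrite -mulrA; apply: IM => //; apply: Tu.
have TR r : R r -> Eend I r by move=> Rr i; apply: submoduleM.
have H'T : subset_k H' (Eend I).
  by apply: mulmod_sub => // a y Ia /(_ a Ia); rewrite mulrC.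
have LY b : L b -> Y b by move=> Lb i /Lb; apply: TR.
have H'1 : wspan H' 1.
  move=> M tM; have [NM|NM] := pselect (subset_k N M).
    have [u [h [ul Hh Ruh Muh]]] := trace_inverse rN lN lrad Ndata mH HN endN
      (fun u h uH => @endH u h (endI u uH)) tM NM.
    exists (u * h); split; rewrite // mulr1; apply: mulmod_scale Hh => // i b Ii Lb.
    (* [u * b] lies in [Y]: by [endI] it is enough that [u * (j * b) * h'] is integral, and it lies
       in [N]. *)
    rewrite mulrCA; apply: mem_mulmod => // j Ij; apply: endI => h' Hh'.
    rewrite -(mulrA u) (mulrC b); have [NR _ _] := rN; apply: NR.
    by apply: (inv_mul_radical rN lrad Ndata) => //; apply: HN => //; apply: mem_mulmod.
  (* For the other [M], the module [H], contained in [H'], already has an element outside [M]. *)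
  have [b [Rb [n tb]] Mb] : exists2 b, N b & ~ M b.
    by apply: contrapT => h; apply: NM => b Nb; apply: contrapT => Mb; apply: h; exists b.
  have [s [Rs Ms Hs]] := tspan_wspan mH tb tM.
  exists (s * b ^+ n.+1); split; rewrite ?mulr1.
  - by apply: RM => //; apply: RX.
  - by apply: tmax_mulN => //; [exact: RX|exact: tmax_expN].
  - have [e [eI ->]] := Hs; exists e; split=> // p /eI[Ip Lp]; split=> //; exact: LY.
move=> x; split.
  move/(wclE mH') => wx i Ii; apply: Iw => M /wx[s [Rs Ms /H'T Tsx]].
  by exists s; split=> //; rewrite mulrA; apply: Tsx.
(* [H'] is stable under [Eend I], so [1] in its w-closure brings in all of [Eend I]. *)
move=> Tx; apply/(wclE mH') => M /H'1[s [Rs Ms H's]].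
exists s; split=> //; rewrite mulr1 in H's; rewrite mulrC.
apply: mulmod_scale H's => // i y Ii Yy; rewrite mulrA; apply: mem_mulmod => //.
exact: Tx.
Qed.

End PvMDTheory.
End Closures.

Theorem theorem2p4 (K : fieldType) (R : K -> Prop) :
  domain_with_qf R -> PvMD R ->
  let i := gen_krull R in
  let ii := (forall I, radical_tideal R I -> divisorial R I) /\
            (forall I, divisorial_ideal R I -> wstable R I) in
  let iii := forall I, radical_tideal R I -> wstable R I in
  let iv := forall P, tprime R P -> wstable R P in
  [/\ i <-> ii, i <-> iii & i <-> iv].
Proof.
move=> domR pvmd i ii iii iv.
have i_ii : i -> ii.
  move=> [sd acc]; split=> I; first exact: radical_tideal_divisorial.
  exact: divisorial_wstable.
have ii_iii : ii -> iii.
  move=> [rad div] I rI; apply: div; split; last exact: rad.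
  by case: rI.
have iii_iv : iii -> iv.
  move=> st P [primeP tP]; apply: st; split=> //; first by case: primeP.
  by move=> x n; apply: (prime_ideal_expr domR primeP).
have iv_i : iv -> i.
  move=> st; split.
    split=> // P tP; apply: wstable_tprime_not_idem => //; exact: st.
  apply: acc_of_rad_fingen => // P tP.
  by apply: wstable_tprime_rad_fingen => //; apply: st.
by split; split; auto.
Qed.
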